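(* For every integer $k \ge 1$, the edge set of the hypercube $Q_{2k+1}$ can be partitioned into the edge sets of $k$ pairwise edge-disjoint spanning trees of $Q_{2k+1}$ together with a set $R$ of remaining edges such that the graph formed by $R$ (with vertex set the set of endpoints of edges of $R$) is a forest with exactly $k$ connected components.
   Context: The $n$-dimensional hypercube $Q_n$ is the graph whose vertices are all binary vectors of length $n$, with two vertices adjacent if and only if they differ in exactly one coordinate. A forest is an acyclic graph. *)

(* Defs.v *)
From mathcomp Require Import all_boot.
Set Implicit Arguments. Unset Strict Implicit. Unset Printing Implicit Defensive.

Definition hvert (n : nat) := {ffun 'I_n -> bool}.

Definition hadj (n : nat) (u v : hvert n) : bool := #|[set i | u i != v i]| == 1.

Definition hedges (n : nat) : {set {set hvert n}} :=
  [set e : {set hvert n} | [exists u : hvert n, exists v : hvert n, hadj u v && (e == [set u; v])]].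

Section Graphs.
Variable T : finType.

Definition erel (F : {set {set T}}) : rel T :=
  fun x y => (x != y) && ([set x; y] \in F).

Definition everts (F : {set {set T}}) : {set T} := \bigcup_(e in F) e.

Definition acyclic (F : {set {set T}}) : Prop :=
  forall c : seq T, 2 < size c -> ~ ucycle (erel F) c.

Definition connected_on (W : {set T}) (F : {set {set T}}) : Prop :=
  forall x y, x \in W -> y \in W -> connect (erel F) x y.

Definition spanning_tree (E F : {set {set T}}) : Prop :=
  [/\ F \subset E, connected_on [set: T] F & acyclic F].

Definition ecomponents (F : {set {set T}}) : {set {set T}} :=
  [set [set y | connect (erel F) x y] | x in everts F].
End Graphs.

(* Main.v *)
Require Import Defs.
From mathcomp Require Import all_boot zify.
Set Implicit Arguments. Unset Strict Implicit. Unset Printing Implicit Defensive.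

(** By induction on k, Q_2k splits into k spanning trees T_0, ..., T_(k-1) and
    a matching of k edges v_i w_i.  For Q_(2k+2) = Q_2k x C_4 with copies
    A, B, C, D: the copies of T_i (0 < i) are joined by the vertical edges AB,
    BC, CD at v_i; T_0 in A and B, and T_0 in C and D, grow into two new trees
    through the remaining vertical edges, where a vertex whose vertical edge was
    given away hangs on its matching edge instead.  The new matching consists of
    the matching in A and of v_0 w_0 in C.

    For Q_(2k+1) = Q_2k x K_2 with copies A, B: the two copies of T_i (0 < i)
    are joined at v_i; T_0 in B takes the vertical edges outside the v_i and the
    matching of A; the remainder is T_0 in A, the matching of B and the vertical
    edge at v_0, so its components correspond to the v_i in B.

    Acyclicity is never checked by hand: the classes are connected, and as
    Q_n has n 2^(n-1) edges they have no room for more than |V| - 1 edges.  The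
    remainder is treated likewise after adding vertical edges that make it a
    connected spanning subgraph. *)

(** * Counting edges to detect acyclicity *)

Section EdgeSets.
Variable T : finType.
Implicit Types (F G : {set {set T}}) (x y : T).

Lemma erel_sym F : symmetric (erel F).
Proof. by move=> x y; rewrite /erel eq_sym setUC. Qed.

Lemma connect_erel_sym F : connect_sym (erel F).
Proof. exact: (sym_connect_sym (@erel_sym F)). Qed.

Lemma acyclic_sub F G : F \subset G -> acyclic G -> acyclic F.
Proof.
move=> /subsetP FG aG c c2 /andP[cc uc]; apply: (aG c c2); rewrite /ucycle uc andbT.
by apply: sub_cycle cc => x y /andP[xy /FG]; rewrite /erel xy.
Qed.

Lemma eq_set2 x y u v :
  [set x; y] = [set u; v] -> (x = u /\ y = v) \/ (x = v /\ y = u).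
Proof.
move=> E.
have xuv : x \in [set u; v] by rewrite -E set21.
have yuv : y \in [set u; v] by rewrite -E set22.
have uxy : u \in [set x; y] by rewrite E set21.
have vxy : v \in [set x; y] by rewrite E set22.
case/set2P: xuv => xE; case/set2P: yuv => yE; auto; subst x y.
- by left; case/set2P: vxy => ->.
- by left; case/set2P: uxy => ->.
Qed.

(** Grow a set [S] from a root [r] one vertex at a time. Connectivity always supplies an edge
    leaving [S], and adding its far end puts a new edge inside [S]. *)
Lemma connected_card F : connected_on [set: T] F -> #|T| <= #|F|.+1.
Proof.
move=> conF; case: (pickP (mem T)) => [r _|T0]; last by rewrite (eq_card0 T0).
suff H j : j < #|T| -> exists S : {set T},
    [/\ r \in S, #|S| = j.+1 & j <= #|[set e in F | e \subset S]|].
  have T0 : 0 < #|T| by apply/card_gt0P; exists r.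
  have [|S [_ _ le]] := H #|T|.-1; first by rewrite prednK.
  rewrite -(prednK T0) ltnS (leq_trans le) // subset_leq_card //.
  by apply/subsetP => e; rewrite inE => /andP[].
elim: j => [_|j IH jT].
  by exists [set r]; rewrite inE eqxx cards1.
have [S [rS cS le]] := IH (ltnW jT).
have [x xS [y yS xy]] : exists2 x, x \in S & exists2 y, y \notin S & erel F x y.
  have [z zS] : exists z, z \notin S.
    apply/existsP; rewrite -negb_forall; apply/negP => /forallP ST.
    move: jT; rewrite -cS ltnNge subset_leq_card //.
    by apply/subsetP => z _; apply: ST.
  case: (pickP [pred p | [&& p.1 \in S, p.2 \notin S & erel F p.1 p.2]]).
    by move=> [x y] /and3P[xS yS xy]; exists x => //; exists y.
  (* With no edge leaving it, [S] would be closed under adjacency, so [r] could not reach [z]. *)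
  move=> noe; have: closed (erel F) [in S].
    apply: intro_closed; first exact: connect_erel_sym.
    move=> x y xy xS; apply/negPn/negP => yS.
    by have := noe (x, y); rewrite /= xS yS xy.
  move=> /closed_connect/(_ _ _ (conF r z (in_setT _) (in_setT _))).
  by rewrite /= rS (negbTE zS).
exists (y |: S); split; first by rewrite inE rS orbT.
  by rewrite cardsU1 yS cS.
case/andP: xy => _ xyF.
apply: leq_ltn_trans le _; apply: proper_card; apply/properP; split.
  apply/subsetP => e; rewrite !inE => /andP[-> eS] /=.
  exact: subset_trans eS (subsetUr _ _).
exists [set x; y]; rewrite !inE xyF /=.
  by apply/subsetP => z; rewrite !inE => /orP[/eqP->|->]; rewrite ?xS ?orbT.
apply/subsetPn; exists y; by rewrite ?inE ?eqxx ?orbT.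
Qed.

(** Deleting one edge of a cycle keeps the graph connected, but leaves fewer edges than
    [connected_card] demands. *)
Lemma connected_acyclic F : connected_on [set: T] F -> #|F| < #|T| -> acyclic F.
Proof.
move=> conF cardF [|x [|y c]] //= c2 /andP[/= /andP[xy pyc] /andP[xyc /andP[yc uc]]].
pose G := F :\ [set x; y].
have xyF : [set x; y] \in F by case/andP: xy.
have xyG : connect (erel G) y x.
  (* The rest of the cycle leads from [y] back to [x] without the edge [xy]: its first edge ends at
     some [z] other than [x], and the later edges miss [y]. *)
  apply/connectP; exists (rcons c x); last by rewrite last_rcons.
  have G_of u v : u != v -> [set u; v] != [set x; y] -> erel F u v -> erel G u v.
    by move=> uv ne; rewrite /erel !inE uv ne.
  case: c c2 pyc xyc yc uc => // z c _.
  rewrite !inE /= => /andP[yz pz]; rewrite !negb_or => /and3P[xNy xNz xc].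
  move=> /andP[yNz yc] /andP[zc uc].
  apply/andP; split.
    apply: G_of yz => //; apply/eqP => /eq_set2[[/eqP]|[_ /eqP]].
      by rewrite eq_sym (negbTE xNy).
    by rewrite eq_sym (negbTE xNz).
  have: y \notin z :: c by rewrite inE negb_or yNz.
  elim: c z pz {xNz xc yNz yc zc uc yz} => [|t c IH] z /=.
    rewrite inE andbT => zx yz; rewrite andbT; apply: G_of => //.
      by case/andP: zx.
    by apply/eqP => /eq_set2[[_ /eqP]|[/eqP]]; rewrite ?(negbTE xNy) 1?eq_sym ?(negbTE yz).
  move=> /andP[zt pt]; rewrite inE negb_or => /andP[yz yc].
  rewrite IH // andbT; apply: G_of => //; first by case/andP: zt.
  apply/eqP => /eq_set2[[_ E]|[/eqP]]; last by rewrite eq_sym (negbTE yz).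
  by move: yc; rewrite E inE eqxx.
have conG : connected_on [set: T] G.
  move=> u v _ _; apply: (connect_sub _ (conF u v (in_setT _) (in_setT _))) => {}u {}v uv.
  have [E|ne] := eqVneq [set u; v] [set x; y].
    by case: (eq_set2 E) => -[-> ->] //; rewrite connect_erel_sym.
  by apply: connect1; case/andP: uv => u1 u2; rewrite /erel u1 !inE ne.
have := leq_trans cardF (connected_card conG).
by rewrite (cardsD1 [set x; y] F) xyF ltnn.
Qed.
End EdgeSets.

(** * Splitting off the first coordinate of the cube *)

Section Cube.
Variable n : nat.
Implicit Types (x y : hvert n) (u v : hvert n.+1) (a b : bool).

Definition hcons a x : hvert n.+1 := [ffun i => oapp x a (unlift ord0 i)].
Definition hhd u : bool := u ord0.
Definition htl u : hvert n := [ffun i => u (lift ord0 i)].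

Lemma hhd_cons a x : hhd (hcons a x) = a.
Proof. by rewrite /hhd ffunE unlift_none. Qed.

Lemma htl_cons a x : htl (hcons a x) = x.
Proof. by apply/ffunP => i; rewrite !ffunE liftK. Qed.

Lemma hcons_eta u : hcons (hhd u) (htl u) = u.
Proof. by apply/ffunP => i; rewrite ffunE; case: unliftP => [j|] ->; rewrite /= ?ffunE. Qed.

Lemma eq_hcons a b x y : (hcons a x == hcons b y) = (a == b) && (x == y).
Proof.
apply/eqP/andP => [E|[/eqP-> /eqP->]] //.
by rewrite -(hhd_cons a x) -{2}(htl_cons a x) E hhd_cons htl_cons.
Qed.

Lemma hadj_cons a b x y :
  hadj (hcons a x) (hcons b y) = if a == b then hadj x y else x == y.
Proof.
(* As a sum over coordinates, the Hamming distance splits at the first one. *)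
have dE m (u v : hvert m) : #|[set i | u i != v i]| = \sum_(i < m) (u i != v i).
  by rewrite cardsE -sum1_card big_mkcond.
rewrite /hadj !dE big_ord_recl !ffunE unlift_none /=.
under eq_bigr => i _ do rewrite !ffunE liftK /=.
case: (a =P b) => /= _; rewrite ?add0n // add1n eqSS sum_nat_eq0.
apply/forallP/eqP => [H|-> i]; last by rewrite eqxx.
by apply/ffunP => i; apply/eqP; move: (H i); rewrite implyTb eqb0 negbK.
Qed.
End Cube.

Lemma hadj_sym n : symmetric (@hadj n).
Proof.
move=> u v; rewrite /hadj; congr (#|pred_of_set _| == 1).
by apply/setP => i; rewrite !inE eq_sym.
Qed.

Lemma hadj_irr n : irreflexive (@hadj n).
Proof.
by move=> u; rewrite /hadj; apply/eqP; under eq_finset do rewrite eqxx; rewrite cards0.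
Qed.

Lemma card_hvert n : #|hvert n| = 2 ^ n.
Proof. by rewrite card_ffun card_bool card_ord. Qed.

Lemma hedgesP n (e : {set hvert n}) :
  reflect (exists u v, hadj u v /\ e = [set u; v]) (e \in hedges n).
Proof.
rewrite inE; apply: (iffP existsP) => [[u /existsP[v /andP[uv /eqP->]]]|[u [v [uv ->]]]].
  by exists u, v.
by exists u; apply/existsP; exists v; rewrite uv eqxx.
Qed.

(** Every edge of the next cube lies in one of two copies of the smaller cube or joins corresponding
    vertices. This upper bound is what later leaves the colour classes no room for cycles. *)
Lemma card_hedges n : 2 * #|hedges n| <= n * 2 ^ n.
Proof.
elim: n => [|n IH].
  rewrite mul0n leqn0 muln_eq0 /= cards_eq0; apply/eqP/setP => e; rewrite in_set0.
  apply/negbTE/negP => /hedgesP[u [v [uv _]]].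
  by move: uv; have -> : u = v; [apply/ffunP => -[] | rewrite hadj_irr].
pose lift b (e : {set hvert n}) := hcons b @: e.
pose cross := [set [set hcons false x; hcons true x] | x : hvert n].
have sub : hedges n.+1 \subset lift false @: hedges n :|: lift true @: hedges n :|: cross.
  apply/subsetP => e /hedgesP[u [v [uv ->]]]; move: uv.
  rewrite -(hcons_eta u) -(hcons_eta v); move: (hhd u) (htl u) (hhd v) (htl v) => a x b y.
  rewrite hadj_cons; case: eqP => [->|ab] xy.
    rewrite inE; apply/orP; left.
    have L : [set hcons b x; hcons b y] \in lift b @: hedges n.
      by apply/imsetP; exists [set x; y]; [apply/hedgesP; exists x, y | rewrite /lift imsetU1 imset_set1].
    by rewrite inE; case: b L => ->; rewrite ?orbT.
  rewrite inE; apply/orP; right; apply/imsetP; exists x => //.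
  by rewrite -(eqP xy); case: a b ab => [] [] //; rewrite setUC.
rewrite expnS mulnCA leq_pmul2l // mulSn addnC.
apply: leq_trans (subset_leq_card sub) _; apply: leq_trans (leq_card_setU _ _) _.
apply: leq_add; last by rewrite -card_hvert leq_imset_card.
apply: leq_trans (leq_card_setU _ _) _; apply: leq_trans IH.
by rewrite mul2n -addnn leq_add ?leq_imset_card.
Qed.

(** * Packings as edge colourings *)

Definition crel n (col : hvert n -> hvert n -> nat) (c : nat) : rel (hvert n) :=
  fun x y => hadj x y && (col x y == c).

(* Colours below k give k disjoint connected spanning subgraphs of Q_n; the
   edges x -- m x with x in vs form a matching avoiding all of them. *)
Record packing k n (col : hvert n -> hvert n -> nat) (vs : seq (hvert n))
    (m : hvert n -> hvert n) : Prop := Packing {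
  packing_sym : forall x y, hadj x y -> col x y = col y x;
  packing_conn : forall c, c < k -> forall x y, connect (crel col c) x y;
  packing_uniq : uniq vs;
  packing_size : size vs = k;
  packing_inj : {in vs &, injective m};
  packing_match : {in vs, forall x, [/\ hadj x (m x), k <= col x (m x) & m x \notin vs]}
}.

Section Crel.
Variables (n : nat) (col : hvert n -> hvert n -> nat).
Hypothesis col_sym : forall x y, hadj x y -> col x y = col y x.

Lemma crel_sym c : symmetric (crel col c).
Proof.
by move=> x y; rewrite /crel hadj_sym; case: (boolP (hadj y x)) => //= /col_sym ->.
Qed.

Lemma connect_crel_sym c : connect_sym (crel col c).
Proof. exact: sym_connect_sym (@crel_sym c). Qed.

Lemma connect_hub c h :
  (forall x, connect (crel col c) x h) -> forall x y, connect (crel col c) x y.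
Proof.
by move=> H x y; apply: connect_trans (H x) _; rewrite connect_crel_sym.
Qed.
End Crel.

Lemma connect_map (T U : finType) (e : rel T) (r : rel U) (f : T -> U) :
  (forall x y, e x y -> r (f x) (f y)) ->
  forall x y, connect e x y -> connect r (f x) (f y).
Proof.
move=> er x y /connectP[p pth ->]; elim: p x pth => //= z p IH x /andP[xz pth].
exact: connect_trans (connect1 (er _ _ xz)) (IH _ pth).
Qed.

(** * Induction step: two more dimensions *)

Section Step.
Variables (k n : nat) (col : hvert n -> hvert n -> nat) (vs : seq (hvert n)).
Variables (m : hvert n -> hvert n) (v0 : hvert n).
Hypothesis pk : packing k col vs m.
Hypotheses (v0vs : v0 \in vs) (v0idx : index v0 vs = 0).

Definition quad a b x : hvert n.+2 := hcons a (hcons b x).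

(* The four copies of Q_n are visited by the 4-cycle
   A = (false, false), B = (false, true), C = (true, true), D = (true, false).
   The old tree 0 of A and B is extended to the new tree 0, that of C and D to
   the new tree k; the leftover edges re-attach vertices whose vertical edges
   are given away. *)
Definition copy_col a b (c : nat) (touch : bool) : nat :=
  if a && (c == 0) then k else
  if c < k then c else
  if a then if b && touch then k.+1 else 0
  else if b then k else k.+1.

(** [j] is the position in [vs], equal to [k] off [vs]. For tree 0, the edge AB at [v0] joins its
    two halves, C hangs on B at [v0] and off [vs], and D hangs on C off [vs]. For tree [k], the edge
    CD at [v0] joins the halves, A hangs on D everywhere and B on A off [vs]. Trees strictly between
    use AB, BC and CD at their own vertex. *)
Definition vert_col a b a' (j : nat) : nat :=
  if a == a' then
    if a then if j == 0 then k else if j == k then 0 else j else j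
  else if b then if j == k then 0 else j else k.

Definition step_col (u v : hvert n.+2) : nat :=
  let: (a, b, x) := (hhd u, hhd (htl u), htl (htl u)) in
  let: (a', b', y) := (hhd v, hhd (htl v), htl (htl v)) in
  if (a == a') && (b == b') then copy_col a b (col x y) ((x == v0) || (y == v0))
  else vert_col a b a' (index x vs).

Definition step_vs := rcons [seq quad false false x | x <- vs] (quad true true v0).

Definition step_m (u : hvert n.+2) : hvert n.+2 :=
  quad (hhd u) (hhd (htl u)) (m (htl (htl u))).

Lemma step_colE a b x a' b' y :
  step_col (quad a b x) (quad a' b' y) =
  if (a == a') && (b == b') then copy_col a b (col x y) ((x == v0) || (y == v0))
  else vert_col a b a' (index x vs).
Proof. by rewrite /step_col /quad !(htl_cons, hhd_cons). Qed.

Lemma quad_eta u : quad (hhd u) (hhd (htl u)) (htl (htl u)) = u.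
Proof. by rewrite /quad !hcons_eta. Qed.

Lemma hadj_quad a b x a' b' y :
  hadj (quad a b x) (quad a' b' y) =
  if a == a' then if b == b' then hadj x y else x == y else (b == b') && (x == y).
Proof. by rewrite !hadj_cons eq_hcons. Qed.

Lemma step_m_quad a b x : step_m (quad a b x) = quad a b (m x).
Proof. by rewrite /step_m /quad !(htl_cons, hhd_cons). Qed.

Lemma quad_inj a b : injective (quad a b).
Proof. by move=> x y /eqP; rewrite !eq_hcons !eqxx => /eqP. Qed.

Lemma k_gt0 : 0 < k.
Proof. by rewrite -(packing_size pk); case: vs v0vs. Qed.

Lemma step_sym u v : hadj u v -> step_col u v = step_col v u.
Proof.
rewrite -(quad_eta u) -(quad_eta v).
move: (hhd u) (hhd (htl u)) (htl (htl u)) (hhd v) (hhd (htl v)) (htl (htl v)).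
move=> a b x a' b' y; rewrite hadj_quad !step_colE.
case: a a' b b' => [] [] [] [] //=; try by move/eqP->.
all: by move=> xy; rewrite (packing_sym pk xy) orbC.
Qed.

Local Notation link c := (connect (crel step_col c)).

Lemma link_sym c u v : link c u v -> link c v u.
Proof. by rewrite (connect_crel_sym step_sym). Qed.

Lemma link_copy a b c d x y : c < k -> d = (if a && (c == 0) then k else c) ->
  link d (quad a b x) (quad a b y).
Proof.
move=> ck ->; apply: connect_map (packing_conn pk ck x y) => {}x {}y /andP[xy /eqP cxy].
by rewrite /crel hadj_quad step_colE !eqxx xy /= cxy /copy_col ck.
Qed.

Lemma link_vert a b a' b' d x : (a == a') = (b != b') ->
  vert_col a b a' (index x vs) = d -> link d (quad a b x) (quad a' b' x).
Proof.
move=> ab ex; apply: connect1; rewrite /crel hadj_quad step_colE ab ex !eqxx.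
by rewrite andNb eqxx; case: (b == b').
Qed.

(** The edge at [v0] in C is excluded because it enters the new matching. Since [m x] lies off [vs],
    it never equals [v0], so the test for touching [v0] depends on [x] alone. *)
Lemma link_match a b d x : x \in vs -> (x == v0 -> ~~ (a && b)) ->
  d = (if a then 0 else if b then k else k.+1) ->
  link d (quad a b x) (quad a b (m x)).
Proof.
move=> xvs xv ->; apply: connect1; have [xm kc mvs] := packing_match pk xvs.
rewrite /crel hadj_quad step_colE !eqxx xm /= /copy_col.
have -> : (m x == v0) = false by apply: contraNF mvs => /eqP->.
have -> : (col x (m x) == 0) = false by rewrite gtn_eqF // (leq_trans k_gt0).
rewrite andbF ltnNge kc orbF /=.
by case: a b xv => [] [] //=; case: eqP => // _ /(_ isT).
Qed.

Lemma index_notin x : x \notin vs -> index x vs = k.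
Proof. by move=> /memNindex->; rewrite (packing_size pk). Qed.

Lemma match_notin x : x \in vs -> m x \notin vs.
Proof. by case/(packing_match pk). Qed.

Lemma step_conn_first u v : link 0 u v.
Proof.
have k0 := k_gt0; have k0N : (0 == k) = false by rewrite ltn_eqF.
have AA x y : link 0 (quad false false x) (quad false false y) by apply: link_copy k0 _.
have BB x y : link 0 (quad false true x) (quad false true y) by apply: link_copy k0 _.
have AB : link 0 (quad false false v0) (quad false true v0).
  by apply: link_vert => //; rewrite /vert_col v0idx.
have CB0 x : x \notin vs -> link 0 (quad true true x) (quad false true x).
  by move=> xvs; apply: link_vert; rewrite // /vert_col index_notin //= eqxx.
have CB x : exists y, link 0 (quad true true x) (quad false true y).
  have [xvs|] := boolP (x \in vs); last by move=> /CB0; exists x.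
  have [->|xv] := eqVneq x v0.
    by exists v0; apply: link_vert; rewrite // /vert_col v0idx /= k0N.
  (* The vertical edge at [x] belongs to another tree, so the path first follows the matching to
     [m x], which lies off [vs] and keeps its vertical edge. *)
  exists (m x); apply: connect_trans (CB0 _ (match_notin xvs)).
  by apply: link_match => //; rewrite (negbTE xv).
have DC0 x : x \notin vs -> link 0 (quad true false x) (quad true true x).
  by move=> xvs; apply: link_vert; rewrite // /vert_col index_notin //= eqxx eq_sym k0N.
have DC x : exists y, link 0 (quad true false x) (quad true true y).
  have [xvs|] := boolP (x \in vs); last by move=> /DC0; exists x.
  exists (m x); apply: connect_trans (DC0 _ (match_notin xvs)).
  by apply: link_match => //; rewrite andbF.
have BA x : link 0 (quad false true x) (quad false false v0).
  exact: connect_trans (BB _ _) (link_sym AB).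
have CA x : link 0 (quad true true x) (quad false false v0).
  by have [y /connect_trans] := CB x; apply.
apply: (connect_hub step_sym (h := quad false false v0)) => {u v} u.
rewrite -(quad_eta u); move: (hhd u) (hhd (htl u)) (htl (htl u)) => [] [] x //.
by have [y /connect_trans] := DC x; apply.
Qed.

Lemma step_conn_last u v : link k u v.
Proof.
have k0 := k_gt0.
have CC x y : link k (quad true true x) (quad true true y) by apply: link_copy k0 _.
have DD x y : link k (quad true false x) (quad true false y) by apply: link_copy k0 _.
have CD : link k (quad true true v0) (quad true false v0).
  by apply: link_vert => //; rewrite /vert_col v0idx.
have AD x : link k (quad false false x) (quad true false x) by apply: link_vert.
have BA0 x : x \notin vs -> link k (quad false true x) (quad false false x).
  by move=> xvs; apply: link_vert; rewrite // /vert_col index_notin.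
have BA x : exists y, link k (quad false true x) (quad false false y).
  have [xvs|] := boolP (x \in vs); last by move=> /BA0; exists x.
  exists (m x); apply: connect_trans (BA0 _ (match_notin xvs)).
  by apply: link_match => //; rewrite andbF.
have hA x : link k (quad false false x) (quad true false v0).
  exact: connect_trans (AD x) (DD _ _).
apply: (connect_hub step_sym (h := quad true false v0)) => {u v} u.
rewrite -(quad_eta u); move: (hhd u) (hhd (htl u)) (htl (htl u)) => [] [] x //.
  exact: connect_trans (CC _ _) CD.
by have [y /connect_trans] := BA x; apply.
Qed.

(** The four copies of the old tree are chained D, C, B, A at the vertex of [vs] with index [c]. *)
Lemma step_conn_old c u v : 0 < c < k -> link c u v.
Proof.
move=> /andP[c0 ck]; set x := nth v0 vs c.
have xvs : x \in vs by rewrite mem_nth ?(packing_size pk).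
have ix : index x vs = c by rewrite index_uniq ?(packing_uniq pk) ?(packing_size pk).
have c0N : (c == 0) = false by rewrite gtn_eqF.
have ckN : (c == k) = false by rewrite ltn_eqF.
have PP a b y z : link c (quad a b y) (quad a b z).
  by apply: link_copy ck _; rewrite c0N andbF.
have BA : link c (quad false true x) (quad false false x).
  by apply: link_vert; rewrite // /vert_col ix.
have CB : link c (quad true true x) (quad false true x).
  by apply: link_vert; rewrite // /vert_col ix /= ckN.
have DC : link c (quad true false x) (quad true true x).
  by apply: link_vert; rewrite // /vert_col ix /= ckN c0N.
have CA := connect_trans CB BA.
apply: (connect_hub step_sym (h := quad false false x)) => {u v} u.
rewrite -(quad_eta u); move: (hhd u) (hhd (htl u)) (htl (htl u)) => [] [] y //;
  apply: connect_trans (PP _ _ y x) _ => //.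
exact: connect_trans DC CA.
Qed.

Lemma step_packing : packing k.+1 step_col step_vs step_m.
Proof.
have k0 := k_gt0.
split; first exact: step_sym.
- move=> c; rewrite ltnS leq_eqVlt => /orP[/eqP-> u v|ck u v]; first exact: step_conn_last.
  by case: c ck => [|c] ck; [apply: step_conn_first | apply: step_conn_old].
- rewrite rcons_uniq map_inj_uniq ?(packing_uniq pk) ?andbT; last exact: quad_inj.
  by apply/negP => /mapP[x _ /eqP]; rewrite eq_hcons.
- by rewrite size_rcons size_map (packing_size pk).
- move=> u v; rewrite !mem_rcons !inE => uE vE.
  have H w : w \in step_vs -> exists a x, x \in vs /\ w = quad a a x.
    rewrite mem_rcons inE => /orP[/eqP->|/mapP[x xvs ->]]; first by exists true, v0.
    by exists false, x.
  have [|a [x [xvs ->]]] := H u; first by rewrite mem_rcons inE.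
  have [|b [y [yvs ->]]] := H v; first by rewrite mem_rcons inE.
  rewrite !step_m_quad => /eqP; rewrite !eq_hcons => /and3P[/eqP-> _ /eqP].
  by move=> /(packing_inj pk xvs yvs) ->.
- move=> u; rewrite mem_rcons inE => uE.
  (* The new matching sits in A for all of [vs], but in C only at [v0]; the implication [xa] records
     this. *)
  have [a [x [xvs ->  xa]]] : exists a x,
      [/\ x \in vs, u = quad a a x & a ==> (x == v0)].
    case/orP: uE => [/eqP->|/mapP[x xvs ->]]; first by exists true, v0; rewrite eqxx.
    by exists false, x.
  have [xm kc mvs] := packing_match pk xvs.
  rewrite step_m_quad hadj_quad step_colE !eqxx; split => //.
    have -> : copy_col a a (col x (m x)) ((x == v0) || (m x == v0)) = k.+1 => //.
    rewrite /copy_col (ltnNge _ k) kc.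
    have -> : (col x (m x) == 0) = false by rewrite gtn_eqF // (leq_trans k0).
    by case: a xa => //= ->.
  rewrite mem_rcons inE negb_or; apply/andP; split.
    by rewrite !eq_hcons; apply: contraNN mvs => /and3P[_ _ /eqP->].
  by apply/negP => /mapP[y yvs /eqP]; rewrite !eq_hcons => /and3P[_ _ /eqP E]; move: mvs; rewrite E yvs.
Qed.
End Step.

(** * Packings of all even-dimensional cubes *)

Lemma packing_exists k : 0 < k -> exists col vs m, @packing k (2 * k) col vs m.
Proof.
case: k => // k _; elim: k => [|k [col [vs [m pk]]]].
  rewrite muln1; pose o : hvert 1 := [ffun=> false]; pose o' : hvert 1 := [ffun=> true].
  have oo' u : {u = o} + {u = o'}.
    by case E: (u ord0); [right | left]; apply/ffunP => i; rewrite ffunE (ord1 i).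
  have hoo' : hadj o o'.
    rewrite /hadj; apply/cards1P; exists ord0; apply/setP => i.
    by rewrite (ord1 i) !inE !ffunE.
  have oNo' : (o == o') = false by apply/eqP => /ffunP/(_ ord0); rewrite !ffunE.
  (* In the 4-cycle, colour 1 marks the single matching edge; the other three edges form a spanning
     path of colour 0. *)
  pose col (u v : hvert 2) : nat := (htl u == o) && (htl v == o).
  have sym u v : hadj u v -> col u v = col v u by rewrite /col andbC.
  exists col, [:: hcons false o], (fun u => hcons (~~ hhd u) (htl u)).
  have e1 a b x y : hadj (hcons a x) (hcons b y) -> ~~ ((x == o) && (y == o)) ->
      connect (crel col 0) (hcons a x) (hcons b y).
    by move=> uv xy; apply: connect1; rewrite /crel uv /col !htl_cons (negbTE xy).
  split=> //.
  - case=> // _; apply: (connect_hub sym (h := hcons false o)) => u.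
    rewrite -(hcons_eta u); move: (hhd u) (htl u) => a x.
    have L b : connect (crel col 0) (hcons b o') (hcons b o).
      by apply: e1; rewrite ?hadj_cons ?eqxx 1?hadj_sym // eq_sym oNo'.
    have M : connect (crel col 0) (hcons true o') (hcons false o').
      by apply: e1; rewrite ?hadj_cons //= eq_sym oNo'.
    have ML := connect_trans M (L false).
    case: (oo' x) => ->; case: a => //.
    by apply: connect_trans ML; rewrite (connect_crel_sym sym).
  - by move=> u v; rewrite !inE => /eqP-> /eqP->.
  - move=> u; rewrite inE => /eqP->.
    by rewrite hadj_cons /col !hhd_cons !htl_cons eqxx inE eq_hcons.
have -> : 2 * k.+2 = (2 * k.+1).+2 by lia.
case: vs pk => [|v0 vs] pk; first by have := packing_size pk.
exists (step_col k.+1 col (v0 :: vs) v0), (step_vs (v0 :: vs) v0), (step_m m).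
by apply: step_packing; rewrite ?mem_head //= eqxx.
Qed.

(** * Colour classes as edge sets *)

Section ColourClasses.
Variables (n : nat) (col : hvert n -> hvert n -> nat).
Hypothesis col_sym : forall x y, hadj x y -> col x y = col y x.

Definition colour_class c : {set {set hvert n}} :=
  [set e | [exists u, exists v, crel col c u v && (e == [set u; v])]].

Lemma colour_classP c e :
  reflect (exists u v, crel col c u v /\ e = [set u; v]) (e \in colour_class c).
Proof.
rewrite inE; apply: (iffP existsP) => [[u /existsP[v /andP[uv /eqP->]]]|[u [v [uv ->]]]].
  by exists u, v.
by exists u; apply/existsP; exists v; rewrite uv eqxx.
Qed.

Lemma mem_colour_class c u v : ([set u; v] \in colour_class c) = crel col c u v.
Proof.
apply/colour_classP/idP => [[x [y [xy /eq_set2[][-> ->]]]]|uv] //; last by exists u, v.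
by rewrite crel_sym.
Qed.

Lemma erel_colour_class c : erel (colour_class c) =2 crel col c.
Proof.
move=> u v; rewrite /erel mem_colour_class; apply: andb_idl => /andP[uv _].
by apply: contraTneq uv => ->; rewrite hadj_irr.
Qed.

Lemma connect_colour_class c : connect (erel (colour_class c)) =2 connect (crel col c).
Proof. exact: eq_connect (@erel_colour_class c). Qed.

Lemma colour_class_sub c : colour_class c \subset hedges n.
Proof.
by apply/subsetP => e /colour_classP[u [v [/andP[uv _] ->]]]; apply/hedgesP; exists u, v.
Qed.

Lemma colour_class_disjoint c d : c != d -> [disjoint colour_class c & colour_class d].
Proof.
move=> cd; apply/pred0P => e; apply/negP => /andP[/colour_classP[u [v [uv ->]]]].
rewrite /= mem_colour_class => /andP[_ /eqP E]; case/andP: uv => _.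
by rewrite E eq_sym (negbTE cd).
Qed.

Lemma colour_class_cover k : (forall u v, hadj u v -> col u v <= k) ->
  hedges n = colour_class k :|: \bigcup_(i < k) colour_class i.
Proof.
move=> colk; apply/eqP; rewrite eqEsubset; apply/andP; split.
  apply/subsetP => e /hedgesP[u [v [uv ->]]]; rewrite inE mem_colour_class.
  have := colk u v uv; rewrite leq_eqVlt => /orP[ck|ck]; first by rewrite /crel uv ck.
  apply/orP; right; apply/bigcupP; exists (Ordinal ck) => //.
  by rewrite mem_colour_class /crel uv /=.
rewrite subUset colour_class_sub; apply/bigcupsP => i _; exact: colour_class_sub.
Qed.
End ColourClasses.

(** * The last dimension *)

Section Final.
Variables (k n : nat) (col : hvert n -> hvert n -> nat) (vs : seq (hvert n)).
Variables (m : hvert n -> hvert n) (v0 : hvert n).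
Hypothesis pk : packing k col vs m.
Hypotheses (v0vs : v0 \in vs) (v0idx : index v0 vs = 0).

Definition matched x y : bool := (x \in vs) && (y == m x) || (y \in vs) && (x == m y).

(* In the copy hhd = false the old tree 0 becomes part of the remainder (colour
   k) and tree 0 reaches the copy by vertical edges; the remainder meets the
   other copy in the matching only. *)
Definition final_copy_col a (c : nat) (mt : bool) : nat :=
  if ~~ a && (c == 0) then k else
  if c < k then c else
  if a && mt then k else 0.

(** Index [k] again means off [vs]: there tree 0 crosses to the other copy. The crossing at [v0]
    goes to the remainder, and every other vertex of [vs] joins the two copies of its own tree. *)
Definition final_vert_col (j : nat) : nat :=
  if j == 0 then k else if j == k then 0 else j.

Definition final_col (u v : hvert n.+1) : nat :=
  if hhd u == hhd v
  then final_copy_col (hhd u) (col (htl u) (htl v)) (matched (htl u) (htl v))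
  else final_vert_col (index (htl u) vs).

Lemma final_colE a x b y : final_col (hcons a x) (hcons b y) =
  if a == b then final_copy_col a (col x y) (matched x y) else final_vert_col (index x vs).
Proof. by rewrite /final_col !(htl_cons, hhd_cons). Qed.

Lemma final_sym u v : hadj u v -> final_col u v = final_col v u.
Proof.
rewrite -(hcons_eta u) -(hcons_eta v).
move: (hhd u) (htl u) (hhd v) (htl v) => a x b y.
rewrite hadj_cons !final_colE (eq_sym b); case: eqP => [-> xy|_ /eqP->] //.
by rewrite (packing_sym pk xy) /matched orbC.
Qed.

Local Notation link c := (connect (crel final_col c)).
Let k0 : 0 < k := k_gt0 pk v0vs.

Lemma flink_sym c u v : link c u v -> link c v u.
Proof. by rewrite (connect_crel_sym final_sym). Qed.

Lemma final_col_le u v : final_col u v <= k.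
Proof.
rewrite /final_col /final_copy_col /final_vert_col.
have : index (htl u) vs <= k by rewrite -(packing_size pk) index_size.
case: ifP => _; case: ifP => // _; last by case: ifP.
by case: ifP => [/ltnW //|_ _]; case: ifP.
Qed.

Lemma flink_copy a c d x y : c < k -> d = (if ~~ a && (c == 0) then k else c) ->
  link d (hcons a x) (hcons a y).
Proof.
move=> ck ->; apply: connect_map (packing_conn pk ck x y) => {}x {}y /andP[xy /eqP cxy].
by rewrite /crel hadj_cons final_colE !eqxx xy /= cxy /final_copy_col ck.
Qed.

Lemma fadj_vert a d x : final_vert_col (index x vs) = d ->
  crel final_col d (hcons a x) (hcons (~~ a) x).
Proof. by move=> ex; rewrite /crel hadj_cons final_colE; case: a; rewrite /= ex !eqxx. Qed.

Lemma fadj_match a x : x \in vs ->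
  crel final_col (if a then k else 0) (hcons a x) (hcons a (m x)).
Proof.
move=> xvs; have [xm kc mvs] := packing_match pk xvs.
rewrite /crel hadj_cons final_colE !eqxx xm /= /final_copy_col /matched xvs eqxx /=.
have -> : (col x (m x) == 0) = false by rewrite gtn_eqF // (leq_trans k0).
by rewrite andbF ltnNge kc; case: a.
Qed.

Lemma final_conn_first u v : link 0 u v.
Proof.
have k0N : (k == 0) = false by rewrite gtn_eqF.
have BB x y : link 0 (hcons true x) (hcons true y) by apply: flink_copy k0 _.
have AB0 x : x \notin vs -> link 0 (hcons false x) (hcons true x).
  move=> xvs; apply/connect1/(@fadj_vert false).
  by rewrite /final_vert_col (index_notin pk) // k0N eqxx.
apply: (connect_hub final_sym (h := hcons true v0)) => {u v} u.
rewrite -(hcons_eta u); move: (hhd u) (htl u) => [] x //.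
have [xvs|/AB0 xA] := boolP (x \in vs); last exact: connect_trans xA (BB _ _).
apply: connect_trans (connect1 (fadj_match false xvs)) _.
exact: connect_trans (AB0 _ (match_notin pk xvs)) (BB _ _).
Qed.

Lemma final_conn_old c u v : 0 < c < k -> link c u v.
Proof.
move=> /andP[c0 ck]; set x := nth v0 vs c.
have xvs : x \in vs by rewrite mem_nth ?(packing_size pk).
have ix : index x vs = c by rewrite index_uniq ?(packing_uniq pk) ?(packing_size pk).
have c0N : (c == 0) = false by rewrite gtn_eqF.
have ckN : (c == k) = false by rewrite ltn_eqF.
have PP a y z : link c (hcons a y) (hcons a z).
  by apply: flink_copy ck _; rewrite c0N andbF.
have BA : link c (hcons true x) (hcons false x).
  by apply/connect1/(@fadj_vert true); rewrite /final_vert_col ix c0N ckN.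
apply: (connect_hub final_sym (h := hcons false x)) => {u v} u.
rewrite -(hcons_eta u); move: (hhd u) (htl u) => [] y //.
exact: connect_trans (PP _ _ x) BA.
Qed.

Lemma final_conn c u v : c < k -> link c u v.
Proof.
case: c => [|c] ck; first exact: final_conn_first.
exact: final_conn_old.
Qed.

Lemma final_rest_copy x y : link k (hcons false x) (hcons false y).
Proof. exact: flink_copy k0 _. Qed.

Lemma final_rest_vert : crel final_col k (hcons true v0) (hcons false v0).
Proof. by apply: fadj_vert; rewrite /final_vert_col v0idx. Qed.

(** In the copy [hhd = true], the remainder already ties [v0] to the other copy and each [m x] to
    [x]. Vertical edges at all the other vertices complete it to a connected spanning graph. *)
Definition tops : {set hvert n} := ~: [set x in v0 :: map m vs].
Definition top_edges : {set {set hvert n.+1}} :=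
  [set [set hcons false x; hcons true x] | x in tops].

Local Notation cls := (colour_class final_col).
Local Notation clsP := (colour_classP final_col).

Lemma card_top_edges : #|top_edges| + k.+1 <= 2 ^ n.
Proof.
rewrite -card_hvert -(cardsC [set x in v0 :: map m vs]) addnC leq_add ?leq_imset_card //.
(* These are [k.+1] distinct vertices, as each [m x] lies off [vs] while [v0] lies in it. *)
have u : uniq (v0 :: map m vs).
  rewrite /= map_inj_in_uniq ?(packing_uniq pk) ?andbT; last exact: packing_inj pk.
  by apply/mapP => -[x /(match_notin pk) xm E]; rewrite -E v0vs in xm.
by rewrite cardsE (card_uniqP u) /= size_map (packing_size pk).
Qed.

Lemma rest_top_connected : connected_on [set: hvert n.+1] (cls k :|: top_edges).
Proof.
set S := _ :|: _.
have S1 u v : link k u v -> connect (erel S) u v.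
  apply: connect_sub => {}u {}v uv; apply: connect1.
  move: uv; rewrite -(erel_colour_class final_sym) => /andP[uv uvS].
  by rewrite /erel uv inE uvS.
have BA0 x : x \notin map m vs -> connect (erel S) (hcons true x) (hcons false x).
  move=> xm; have [->|xv] := eqVneq x v0; first exact/S1/connect1/final_rest_vert.
  apply: connect1; rewrite /erel eq_hcons /= inE; apply/orP; right.
  by apply/imsetP; exists x; rewrite ?inE ?(negbTE xv) // setUC.
have AA x : connect (erel S) (hcons false x) (hcons false v0).
  exact: S1 (final_rest_copy _ _).
suff H u : connect (erel S) u (hcons false v0).
  by move=> u v _ _; apply: connect_trans (H u) _; rewrite connect_erel_sym.
rewrite -(hcons_eta u); move: (hhd u) (htl u) => [] x //.
have [/mapP[y yvs ->]|/BA0 xA] := boolP (x \in map m vs); last exact: connect_trans xA (AA _).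
(* [y] is in [vs], hence not itself of the form [m z], so it has a vertical edge available. *)
have yA : connect (erel S) (hcons true y) (hcons false y).
  by apply: BA0; apply/mapP => -[z /(match_notin pk) zm E]; rewrite -E yvs in zm.
apply: connect_trans (connect_trans yA (AA _)).
by rewrite connect_erel_sym; apply/S1/connect1/(fadj_match true).
Qed.

Lemma tree_connected (i : 'I_k) : connected_on [set: hvert n.+1] (cls i).
Proof. by move=> u v _ _; rewrite (connect_colour_class final_sym) final_conn. Qed.

(** * Acyclicity by counting *)

Hypothesis nk : n = 2 * k.

Lemma card_classes : #|cls k| + \sum_(i < k) #|cls i| <= (2 * k).+1 * 2 ^ n.
Proof.
rewrite -nk; have le := card_hedges n.+1; rewrite (colour_class_cover final_sym (k := k)) in le; last first.
  by move=> u v _; apply: final_col_le.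
move: le; rewrite cardsU disjoint_setI0 ?cards0 ?subn0; last first.
  apply/bigcup_disjoint => i _; rewrite disjoint_sym; apply: (colour_class_disjoint final_sym).
  by rewrite ltn_eqF.
rewrite expnS mulnCA leq_pmul2l //; apply: leq_trans.
rewrite leq_add2l -[X in _ <= X]sum1_card partition_disjoint_bigcup; last first.
  by move=> i j ij; apply: (colour_class_disjoint final_sym).
by apply: leq_sum => i _; rewrite sum1_card.
Qed.

Lemma card_tree_ge (i : 'I_k) : 2 * 2 ^ n <= #|cls i|.+1.
Proof. by have := connected_card (tree_connected i); rewrite card_hvert expnS. Qed.

Lemma card_rest_top_ge : 2 * 2 ^ n <= (#|cls k :|: top_edges|).+1.
Proof. by have := connected_card rest_top_connected; rewrite card_hvert expnS. Qed.

Lemma sum_trees_ge (P : pred 'I_k) :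
  #|P| * (2 * 2 ^ n).-1 <= \sum_(i < k | P i) #|cls i|.
Proof.
by rewrite -sum_nat_const; apply: leq_sum => i _; have := card_tree_ge i; lia.
Qed.

(** Put M = 2^n. The other trees have at least 2M-1 edges each, and the remainder at least M+k,
    since at most M-k-1 added edges make it connected. Of the (2k+1)M edges at most 2M-1 are left
    for this tree. *)
Lemma tree_acyclic (i : 'I_k) : acyclic (cls i).
Proof.
apply: connected_acyclic (tree_connected i) _; rewrite card_hvert expnS.
have := card_classes; rewrite (bigD1 i) //=.
have : k.-1 * (2 * 2 ^ n).-1 <= \sum_(j < k | j != i) #|cls j|.
  by have := sum_trees_ge (predC1 i); rewrite cardC1 card_ord.
have := card_rest_top_ge; have := card_top_edges; have := (leq_card_setU (cls k) top_edges).1.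
have := k0; have : 0 < 2 ^ n by rewrite expn_gt0.
move: k (2 ^ _) #|cls i| #|cls k| #|top_edges| (\sum_(j < k | j != i) #|cls j|) #|_ :|: _|.
by move=> [|q] M t r z s rz //=; nia.
Qed.

(** With M = 2^n, the [k] trees leave at most M+k edges; with at most M-k-1 added ones this gives at
    most 2M-1, so even the completed graph is acyclic. *)
Lemma rest_acyclic : acyclic (cls k).
Proof.
apply: (acyclic_sub (subsetUl _ top_edges)).
apply: connected_acyclic rest_top_connected _; rewrite card_hvert expnS.
apply: leq_ltn_trans (leq_card_setU _ _) _.
have := card_classes; have := card_top_edges.
have : k * (2 * 2 ^ n).-1 <= \sum_(j < k) #|cls j|.
  by have := sum_trees_ge predT; rewrite card_ord.
have : 0 < 2 ^ n by rewrite expn_gt0.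
move: (2 ^ _) #|cls k| #|top_edges| (\sum_(j < k) #|cls j|) => M r z s.
nia.
Qed.

(* The vertex (true, y), y in vs, representing the component of u. *)
Definition rep (u : hvert n.+1) : hvert n :=
  if ~~ hhd u then v0 else
  if htl u \in vs then htl u else nth v0 vs (index (htl u) (map m vs)).

Lemma rep_cons a x : rep (hcons a x) =
  if ~~ a then v0 else if x \in vs then x else nth v0 vs (index x (map m vs)).
Proof. by rewrite /rep hhd_cons htl_cons. Qed.

Lemma rep_match x : x \in vs -> rep (hcons true (m x)) = x.
Proof.
move=> xvs; rewrite rep_cons /= (negbTE (match_notin pk xvs)).
exact: nth_index_map (packing_inj pk) xvs.
Qed.

Lemma rep_in x : x \in vs -> rep (hcons true x) = x.
Proof. by rewrite rep_cons => /= ->. Qed.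

Lemma rest_edge u v : crel final_col k u v ->
  [\/ hhd u = false /\ hhd v = false,
      htl u = v0 /\ htl v = v0 |
      exists2 x, x \in vs & [set u; v] = [set hcons true x; hcons true (m x)]].
Proof.
rewrite -(hcons_eta u) -(hcons_eta v).
move: (hhd u) (htl u) (hhd v) (htl v) => a x b y; rewrite !hhd_cons !htl_cons.
have k0N : (0 == k) = false by rewrite ltn_eqF.
rewrite /crel hadj_cons final_colE; case: eqP => [<-|_]; last first.
  case/andP=> /eqP<- E; apply: Or32.
  have i0 : index x vs = 0.
    (* A vertical edge off [vs] has colour 0, which differs from [k], so only index 0 produces
       colour [k]. *)
    by move: E; rewrite /final_vert_col; case: (index x vs =P 0) => // _; case: (index x vs =P k) => // [|ne /eqP //]; rewrite k0N.
  have xvs : x \in vs by rewrite -index_mem i0 (packing_size pk).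
  by split; apply: (index_inj v0 xvs v0vs); rewrite i0 v0idx.
case: a => /andP[xy]; last by move=> _; apply: Or31.
rewrite /final_copy_col /=; case: ltnP => [ck /eqP E|_]; first by rewrite E ltnn in ck.
case: ifP; last by rewrite k0N.
move=> /orP[] /andP[zvs /eqP->] _; apply: Or33; first by exists x.
by exists y; rewrite // setUC.
Qed.

Lemma rep_edge u v : crel final_col k u v -> rep u = rep v.
Proof.
case/rest_edge => [[au av]|[xu xv]|[x xvs /eq_set2[][-> ->]]].
- by rewrite /rep au av.
- by rewrite /rep xu xv v0vs; case: (hhd u); case: (hhd v).
- by rewrite rep_match // rep_in.
- by rewrite rep_match // rep_in.
Qed.

(** As a component invariant, [rep] keeps apart the components of distinct vertices of [vs] in the
    copy [hhd = true]. *)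
Lemma rep_link u v : link k u v -> rep u = rep v.
Proof.
move=> /connectP[p pth ->]; elim: p u pth => //= w p IH u /andP[/rep_edge-> pth].
exact: IH.
Qed.

Lemma rest_link_rep u : u \in everts (cls k) ->
  exists2 y, y \in vs & link k u (hcons true y).
Proof.
case/bigcupP => e /clsP[x [y [xy ->]]] uxy.
(* The old tree 0 spans this whole copy, and its only exit within the remainder is the vertical edge
   at [v0]. *)
have Av z : link k (hcons false z) (hcons true v0).
  apply: connect_trans (final_rest_copy z v0) _.
  exact/flink_sym/connect1/final_rest_vert.
case: (rest_edge xy) => [[ax ay]|[ex ey]|[z zvs E]].
- exists v0; rewrite // -(hcons_eta u).
  by case/set2P: uxy => ->; rewrite ?ax ?ay.
- exists v0; rewrite // -(hcons_eta u).
  have -> : htl u = v0 by case/set2P: uxy => ->.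
  by case: (hhd u).
- exists z => //; move: uxy; rewrite E => /set2P[]-> //.
  exact/flink_sym/connect1/(fadj_match true).
Qed.

(** Sending [y] in [vs] to the component of [hcons true y] is onto by [rest_link_rep] and injective
    by [rep_link]. The matching edge at [y] ensures that this vertex belongs to the remainder. *)
Lemma card_rest_components : #|ecomponents (cls k)| = k.
Proof.
pose comp u := [set v | connect (erel (cls k)) u v].
have compE u v : (v \in comp u) = link k u v.
  by rewrite inE (connect_colour_class final_sym).
have -> : ecomponents (cls k) = [set comp (hcons true y) | y in [set y in vs]].
  apply/setP => C; apply/imsetP/imsetP => [[u uR ->]|[y]].
    have [y yvs uy] := rest_link_rep uR; exists y; first by rewrite inE.
    apply/setP => v; rewrite -/(comp u) !compE.
    by apply: (same_connect (connect_crel_sym final_sym k)).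
  rewrite inE => yvs ->; exists (hcons true y) => //.
  apply/bigcupP; exists [set hcons true y; hcons true (m y)]; last by rewrite set21.
  by rewrite (mem_colour_class final_sym) (fadj_match true).
rewrite card_in_imset.
  by rewrite cardsE (card_uniqP (packing_uniq pk)) (packing_size pk).
move=> x y; rewrite !inE => xvs yvs E.
have : hcons true y \in comp (hcons true x) by rewrite E compE.
by rewrite compE => /rep_link; rewrite !rep_in.
Qed.
End Final.

Theorem mainTheorem4 (k : nat) (hk : 1 <= k) :
  exists (Ts : 'I_k -> {set {set hvert (2 * k).+1}}) (R : {set {set hvert (2 * k).+1}}),
    [/\ forall i, spanning_tree (hedges (2 * k).+1) (Ts i),
        forall i j, i != j -> [disjoint Ts i & Ts j],
        [disjoint R & \bigcup_(i < k) Ts i],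
        hedges (2 * k).+1 = R :|: \bigcup_(i < k) Ts i
      & acyclic R /\ #|ecomponents R| = k].
Proof.
have [col [vs [m pk]]] := packing_exists hk.
have [v0 v0vs v0idx] : exists2 v0, v0 \in vs & index v0 vs = 0.
  case: vs pk => [|v0 vs] pk; first by move: hk; rewrite -(packing_size pk).
  by exists v0; rewrite ?mem_head //= eqxx.
have sym := final_sym pk.
exists (colour_class (final_col k col vs m)), (colour_class (final_col k col vs m) k); split.
- move=> i; split; first exact: colour_class_sub.
    exact: (tree_connected pk v0vs).
  exact: (tree_acyclic pk v0vs v0idx).
- by move=> i j ij; apply: colour_class_disjoint.
- apply/bigcup_disjoint => i _; rewrite disjoint_sym; apply: colour_class_disjoint => //.
  by rewrite ltn_eqF.
- by apply: colour_class_cover => // u v _; apply: final_col_le.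
- by split; [apply: (rest_acyclic pk v0vs v0idx) | apply: (card_rest_components pk v0vs v0idx)].
Qed.
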